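(* Let $J:\mathbb{R}^n\to\mathbb{R}$ be continuously differentiable, and let $s(t)$ be the sinusoidal dither signal with components $s_i(t)=a_i\sin(\omega r_i t)$. Then the average gradient estimate $\bar{\hat g}=(\bar{\hat g}_1,\dots,\bar{\hat g}_n)$, given by $$\bar{\hat g}_i(\theta)=\frac1T\int_0^T m_i(\tau)\,J(\theta+s(\tau))\,d\tau,\qquad m_i(t)=\frac{2}{a_i}\sin(\omega r_i t),\quad T=\frac{2\pi}{\omega},$$ converges to $\nabla J$ as the dither vanishes: for every $\theta\in\mathbb{R}^n$, $\bar{\hat g}(\theta)\to\nabla J(\theta)$ as $a_0\to 0$.
   Context: Here $\omega>0$, each $r_i$ is a fixed nonzero integer, $a_i\neq 0$, and $a_0=\sqrt{\sum_{i=1}^n a_i^2}$. The limit $a_0\to0$ is taken with the ratios $a_i/a_0$ held fixed. The function $\bar{\hat g}_i$ is the average over one period of the gradient estimate $\hat g_i(t,\theta,\xi)=m_i(t)\left(J(\theta+s(t))-\xi\right)$ with $\theta\in\mathbb{R}^n$ and $\xi\in\mathbb{R}$ frozen; it does not depend on $\xi$ because $m_i$ has zero mean over a period.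
   Formalization: The integers r_i are additionally assumed to have pairwise distinct absolute values; without this the claim fails, e.g. n=2, r_1=r_2=1, J(x)=x_2 gives a first component a_2/a_1, a nonzero constant, instead of 0. *)

(* Defs.v *)
From HB Require Import structures.
From mathcomp Require Import all_boot all_order all_algebra.
From mathcomp Require Import all_classical all_reals all_analysis.

Set Implicit Arguments.
Unset Strict Implicit.
Unset Printing Implicit Defensive.

Import Order.TTheory GRing.Theory Num.Theory.
Import numFieldNormedType.Exports.

Local Open Scope ring_scope.
Local Open Scope classical_set_scope.

Definition gradient (R : realType) (n : nat) (J : 'rV[R]_n -> R)
    (x : 'rV[R]_n) : 'rV[R]_n :=
  \row_i 'D_(delta_mx 0 i) J x.

(* There is no topology on the space of linear maps in the library: the
   continuity of the derivative is stated on its coordinates. *)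
Definition continuously_differentiable (R : realType) (n : nat)
    (J : 'rV[R]_n -> R) : Prop :=
  (forall x, differentiable J x) /\ continuous (gradient J).

Definition dither (R : realType) (n : nat) (omega : R) (r : 'I_n -> int)
    (a : 'rV[R]_n) (t : R) : 'rV[R]_n :=
  \row_i (a 0 i * sin (omega * (r i)%:~R * t)).

Definition demodulation (R : realType) (n : nat) (omega : R) (r : 'I_n -> int)
    (a : 'rV[R]_n) (i : 'I_n) (t : R) : R :=
  2 / a 0 i * sin (omega * (r i)%:~R * t).

Definition period (R : realType) (omega : R) : R := 2 * pi / omega.

Definition average_gradient_estimate (R : realType) (n : nat)
    (J : 'rV[R]_n -> R) (omega : R) (r : 'I_n -> int) (a theta : 'rV[R]_n) :
    'rV[R]_n :=
  \row_i ((period omega)^-1 *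
    \int[lebesgue_measure]_(t in `[0, period omega])
      (demodulation omega r a i t * J (theta + dither omega r a t))).

(* The number a_0 attached to the dither amplitudes a. The library norm of
   'rV[R]_n is the sup norm, hence the explicit Euclidean formula. *)
Definition dither_size (R : realType) (n : nat) (a : 'rV[R]_n) : R :=
  Num.sqrt (\sum_i a 0 i ^+ 2).

(* With fixed ratios rho (of size 1) the amplitudes are a = a0 *: rho, where
   the scalar a0 is then indeed the size of a and rho its vector of ratios. *)
Lemma dither_size_scale (R : realType) (n : nat) (rho : 'rV[R]_n) (a0 : R) :
  0 < a0 -> dither_size rho = 1 -> dither_size (a0 *: rho) = a0.
Proof.
move=> a0_gt0 rho1; rewrite /dither_size.
under eq_bigr do rewrite mxE exprMn.
rewrite -mulr_sumr sqrtrM ?sqr_ge0// sqrtr_sqr gtr0_norm//.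
by move: rho1; rewrite /dither_size => ->; rewrite mulr1.
Qed.

Lemma dither_ratioP (R : realType) (n : nat) (rho a : 'rV[R]_n) :
  0 < dither_size a ->
  (forall i, a 0 i / dither_size a = rho 0 i) <->
  a = dither_size a *: rho.
Proof.
move=> a0_gt0; have a0_neq0 := lt0r_neq0 a0_gt0; split=> [aE|aE i].
  by apply/rowP => i; rewrite mxE -aE mulrC divfK.
by rewrite {1}aE mxE mulrC mulKf.
Qed.

(* Main.v *)
(* Expand J(theta + h) = J(theta) + dJ(h) + rem(h) along h = s(t).  The dither
   frequencies have distinct absolute values, so orthogonality of the sines over
   one period makes the average of m_i times the affine part exactly the i-th
   partial derivative.  The remainder is o(|a|) uniformly in t, while m_i is
   O(1/|a_i|), and |a|/|a_i| is fixed by the ratios rho. *)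
Require Import Defs.
From mathcomp Require Import all_boot all_order all_algebra.
From mathcomp Require Import all_classical all_reals all_analysis.
From mathcomp Require Import ring.

Set Implicit Arguments.
Unset Strict Implicit.
Unset Printing Implicit Defensive.

Import Order.TTheory GRing.Theory Num.Theory.
Import numFieldNormedType.Exports.

Local Open Scope ring_scope.
Local Open Scope classical_set_scope.

Lemma continuous_integrable_itv (R : realType) (f : R -> R) (a b : R) :
  continuous f -> lebesgue_measure.-integrable `[a, b] (EFin \o f).
Proof.
move=> cf; apply: continuous_compact_integrable.
  exact: segment_compact.
by apply: continuous_subspaceT => x; exact: cf.
Qed.

Lemma continuous_sumr (R : realType) (I : Type) (s : seq I) (f : I -> R -> R) :
  (forall i, continuous (f i)) -> continuous (fun t => \sum_(i <- s) f i t).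
Proof.
move=> cf t; elim: s => [|i s IHs].
  by under eq_fun do rewrite big_nil; exact: cvg_cst.
under eq_fun do rewrite big_cons.
by apply: cvgD; [exact: cf|exact: IHs].
Qed.

Lemma Rintegral_sum_continuous (R : realType) (I : Type) (s : seq I)
    (f : I -> R -> R) (a b : R) :
  (forall i, continuous (f i)) ->
  \int[lebesgue_measure]_(t in `[a, b]) (\sum_(i <- s) f i t) =
  \sum_(i <- s) \int[lebesgue_measure]_(t in `[a, b]) f i t.
Proof.
move=> cf; elim: s => [|i s IHs].
  rewrite big_nil; under eq_Rintegral do rewrite big_nil.
  by rewrite Rintegral_cst ?mul0r.
rewrite big_cons -IHs; under eq_Rintegral do rewrite big_cons.
rewrite RintegralD //; apply: continuous_integrable_itv => //.
exact: continuous_sumr.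
Qed.

Lemma Rintegral_cst_itv (R : realType) (c T : R) :
  0 <= T -> \int[lebesgue_measure]_(t in `[0, T]) c = c * T.
Proof.
move=> T_ge0; rewrite Rintegral_cst //; congr (_ * _).
have := lebesgue_measure_itv `[0, T]%R; rewrite /= lte_fin => ->.
by case: ltgtP T_ge0 => //= _ _; rewrite subr0.
Qed.

Lemma Rintegral_FTC2 (R : realType) (f F : R -> R) (T : R) :
  0 < T -> continuous f -> (forall x : R, is_derive x 1 F (f x)) ->
  \int[lebesgue_measure]_(t in `[0, T]) f t = F T - F 0.
Proof.
move=> T_gt0 cf dF; rewrite /Rintegral (@continuous_FTC2 _ f F) //.
- by apply: continuous_subspaceT => x; exact: cf.
- have cF x : {for x, continuous F}.
    by apply/differentiable_continuous/derivable1_diffP; case: (dF x).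
  split; [by move=> x _; case: (dF x) | |].
  + exact/cvg_at_right_filter/cF.
  + exact/cvg_at_left_filter/cF.
- by move=> x _; rewrite derive1E; case: (dF x).
Qed.

Lemma continuous_cosM (R : realType) (c : R) :
  continuous (fun t => cos (c * t)).
Proof.
move=> t; apply: (@continuous_comp _ _ _ ( *%R c) (@cos R)).
  exact: mulrl_continuous.
exact: continuous_cos.
Qed.

Lemma continuous_sinM (R : realType) (c : R) :
  continuous (fun t => sin (c * t)).
Proof.
move=> t; apply: (@continuous_comp _ _ _ ( *%R c) (@sin R)).
  exact: mulrl_continuous.
exact: continuous_sin.
Qed.

Lemma Rintegral_cosM (R : realType) (c T : R) : c != 0 -> 0 < T ->
  \int[lebesgue_measure]_(t in `[0, T]) cos (c * t) = sin (c * T) / c.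
Proof.
move=> c0 T_gt0.
have dF (x : R) :
    is_derive x 1 (fun t : R => c^-1 *: sin (c *: t)) (cos (c * x)).
  by apply: is_derive_eq; rewrite /GRing.scale /=; field.
rewrite (Rintegral_FTC2 T_gt0 (@continuous_cosM _ c) dF) /GRing.scale /=.
by rewrite mulr0 sin0 mulr0 subr0 mulrC.
Qed.

Lemma Rintegral_sinM (R : realType) (c T : R) : c != 0 -> 0 < T ->
  \int[lebesgue_measure]_(t in `[0, T]) sin (c * t) = (1 - cos (c * T)) / c.
Proof.
move=> c0 T_gt0.
have dF (x : R) :
    is_derive x 1 (fun t : R => c^-1 *: - cos (c *: t)) (sin (c * x)).
  by apply: is_derive_eq; rewrite /GRing.scale /=; field.
rewrite (Rintegral_FTC2 T_gt0 (@continuous_sinM _ c) dF) /GRing.scale /=.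
by rewrite mulr0 cos0; field.
Qed.

Lemma periodicz (U V : zmodType) (f : U -> V) (T : U) :
  periodic f T -> forall (k : int) (a : U), f (a + T *~ k) = f a.
Proof.
move=> fT [n|n] a; first by rewrite -pmulrn periodicn.
by rewrite NegzE mulrNz -pmulrn -{2}[a](subrK (T *+ n.+1)) periodicn.
Qed.

Lemma sin_period (R : realType) (omega : R) (k : int) :
  omega != 0 -> sin (omega * k%:~R * period omega) = 0.
Proof.
move=> w0; rewrite (_ : _ * _ = 0 + pi *+ 2 *~ k).
  by rewrite (periodicz (@sinD2pi R)) sin0.
by rewrite /period -mulrzl -mulr_natl; field.
Qed.

Lemma cos_period (R : realType) (omega : R) (k : int) :
  omega != 0 -> cos (omega * k%:~R * period omega) = 1.
Proof.
move=> w0; rewrite (_ : _ * _ = 0 + pi *+ 2 *~ k).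
  by rewrite (periodicz (@cosD2pi R)) cos0.
by rewrite /period -mulrzl -mulr_natl; field.
Qed.

Lemma period_gt0 (R : realType) (omega : R) : 0 < omega -> 0 < period omega.
Proof. by move=> w0; rewrite /period divr_gt0 // mulr_gt0 // pi_gt0. Qed.

Lemma Rintegral_cos_period (R : realType) (omega : R) (k : int) : 0 < omega ->
  \int[lebesgue_measure]_(t in `[0, period omega]) cos (omega * k%:~R * t) =
  (k == 0)%:R * period omega.
Proof.
move=> w0; have T0 := period_gt0 w0; have [->|k0] := eqVneq.
  under eq_Rintegral do rewrite mulr0 mul0r cos0.
  by rewrite Rintegral_cst_itv // ltW.
rewrite Rintegral_cosM ?sin_period ?mul0r ?mulf_neq0 ?intr_eq0 //.
all: exact: lt0r_neq0.
Qed.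

Lemma Rintegral_sin_period (R : realType) (omega : R) (k : int) :
  0 < omega -> k != 0 ->
  \int[lebesgue_measure]_(t in `[0, period omega]) sin (omega * k%:~R * t) = 0.
Proof.
move=> w0 k0; have w_neq0 := lt0r_neq0 w0.
rewrite Rintegral_sinM ?mulf_neq0 ?intr_eq0 //; last exact: period_gt0.
by rewrite cos_period // subrr mul0r.
Qed.

Lemma Rintegral_sin_sin_period (R : realType) (omega : R) (p q : int) :
  0 < omega -> p != 0 -> p = q \/ `|p| != `|q| ->
  \int[lebesgue_measure]_(t in `[0, period omega])
    (sin (omega * p%:~R * t) * sin (omega * q%:~R * t)) =
  (p == q)%:R * (period omega / 2).
Proof.
move=> w0 p0 pq.
have sinsin (t : R) : sin (omega * p%:~R * t) * sin (omega * q%:~R * t) =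
    2^-1 * (cos (omega * (p - q)%:~R * t) - cos (omega * (p + q)%:~R * t)).
  rewrite rmorphB rmorphD /= [omega * (_ - _)]mulrBr [omega * (_ + _)]mulrDr.
  by rewrite [(_ - _) * t]mulrBl [(_ + _) * t]mulrDl cosB cosD; field.
have DN : (p + q == 0) = false.
  apply/negbTE; case: pq => [<-|]; first by rewrite -mulr2n mulrn_eq0.
  by apply: contraNneq => /eqP; rewrite addr_eq0 => /eqP->; rewrite normrN.
under eq_Rintegral do rewrite sinsin.
have ic k := @continuous_integrable_itv _ _ 0 (period omega)
  (@continuous_cosM R (omega * k%:~R)).
rewrite RintegralZl //; last first.
  apply: continuous_integrable_itv => x.
  by apply: cvgB; exact: continuous_cosM.
rewrite RintegralB // !Rintegral_cos_period // DN subr_eq0.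
by rewrite mul0r subr0; ring.
Qed.

Lemma continuous_demodulation (R : realType) (n : nat) (omega : R)
    (r : 'I_n -> int) (a : 'rV[R]_n) (i : 'I_n) :
  continuous (demodulation omega r a i).
Proof. by move=> t; apply: cvgMl_tmp; exact: continuous_sinM. Qed.

Lemma average_demodulation_affine (R : realType) (n : nat) (omega : R)
    (r : 'I_n -> int) (a g : 'rV[R]_n) (c : R) (i : 'I_n) :
  0 < omega -> r i != 0 -> (forall j, i != j -> `|r i| != `|r j|) ->
  a 0 i != 0 ->
  (period omega)^-1 * \int[lebesgue_measure]_(t in `[0, period omega])
    (demodulation omega r a i t *
     (c + \sum_j dither omega r a t 0 j * g 0 j)) = g 0 i.
Proof.
move=> w0 ri0 rinj ai0.
pose S (j : 'I_n) (t : R) := sin (omega * (r j)%:~R * t).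
have cS j : continuous (S j) by exact: continuous_sinM.
have cSS j : continuous (fun t => S i t * S j t).
  by move=> t; apply: cvgM; exact: cS.
have cT j : continuous (fun t => 2 / a 0 i * (a 0 j * g 0 j) * (S i t * S j t)).
  by move=> t; apply: cvgMl_tmp; exact: cSS.
have -> : (fun t => demodulation omega r a i t *
    (c + \sum_j dither omega r a t 0 j * g 0 j)) =
  (fun t => 2 / a 0 i * c * S i t +
    \sum_j 2 / a 0 i * (a 0 j * g 0 j) * (S i t * S j t)).
  apply/funext => t; rewrite mulrDr mulr_sumr; congr (_ + _).
    by rewrite /demodulation /S; ring.
  by apply: eq_bigr => j _; rewrite /demodulation mxE /S; ring.
rewrite RintegralD //; last 2 first.
- by apply: continuous_integrable_itv => t; apply: cvgMl_tmp; exact: cS.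
- exact/continuous_integrable_itv/continuous_sumr.
rewrite RintegralZl //; last exact/continuous_integrable_itv/cS.
rewrite Rintegral_sin_period // mulr0 add0r Rintegral_sum_continuous //.
have T0 := lt0r_neq0 (period_gt0 w0).
rewrite (bigD1 i) //= big1 => [|j ji].
  rewrite addr0 RintegralZl //; last exact/continuous_integrable_itv/cSS.
  rewrite Rintegral_sin_sin_period //; last by left.
  by rewrite eqxx mul1r; field; rewrite T0 ai0.
rewrite RintegralZl //; last exact/continuous_integrable_itv/cSS.
have rij : `|r i| != `|r j| by apply: rinj; rewrite eq_sym.
rewrite Rintegral_sin_sin_period //; last by right.
rewrite (_ : (r i == r j) = false) ?mul0r ?mulr0 //.
by apply: contraNF rij => /eqP->.
Qed.

Lemma differential_gradient (R : realType) (n : nat) (J : 'rV[R]_n -> R)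
    (x v : 'rV[R]_n) : differentiable J x ->
  'd J x v = \sum_j v 0 j * gradient J x 0 j.
Proof.
move=> dJ; rewrite [in LHS](row_sum_delta v) linear_sum /=.
by apply: eq_bigr => j _; rewrite linearZ /= mxE deriveE.
Qed.

Lemma gradient_remainder (R : realType) (n : nat) (J : 'rV[R]_n -> R)
    (x : 'rV[R]_n) (e : R) : differentiable J x -> 0 < e ->
  \forall h \near (0 : 'rV[R]_n),
    `|J (x + h) - (J x + \sum_j h 0 j * gradient J x 0 j)| <= e * `|h|.
Proof.
move=> dJ e0; near=> h.
rewrite -differential_gradient // (addrC x) (diff_locallyx dJ) addrC addKr.
by near: h; exact: littleoP.
Unshelve. all: by end_near. Qed.

Lemma mx_norm_le (R : realType) (m n : nat) (x : 'M[R]_(m, n)) (e : R) :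
  0 <= e -> (forall i j, `|x i j| <= e) -> `|x| <= e.
Proof.
by move=> e0 xe; rewrite [`|x|]mx_normrE; apply/bigmax_leP;
  split => // -[i j] _.
Qed.

Lemma le_mx_norm (R : realType) (m n : nat) (x : 'M[R]_(m, n)) i j :
  `|x i j| <= `|x|.
Proof. by rewrite [leRHS]mx_normrE; exact: (le_bigmax _ _ (i, j)). Qed.

Lemma norm_dither (R : realType) (n : nat) (omega : R) (r : 'I_n -> int)
    (a : 'rV[R]_n) (t : R) : `|dither omega r a t| <= `|a|.
Proof.
apply: mx_norm_le => // i j; rewrite ord1 mxE normrM.
by rewrite (le_trans _ (le_mx_norm a 0 j)) // ler_piMr // sin_max.
Qed.

Lemma cvg_rV (T : Type) (U : topologicalType) (n : nat) (F : set_system T)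
    (f : T -> 'rV[U]_n) (l : 'rV[U]_n) : Filter F ->
  (forall i, f x 0 i @[x --> F] --> l 0 i) -> f x @[x --> F] --> l.
Proof.
move=> FF fl A [P lP PA]; rewrite /nbhs /=.
have : \forall x \near F, forall i, P 0 i (f x 0 i).
  by apply: filter_forall => i; exact: fl (lP 0 i).
by apply: filterS => x Px; apply: PA => i j; rewrite ord1.
Qed.

Lemma continuous_dither (R : realType) (n : nat) (omega : R) (r : 'I_n -> int)
    (a : 'rV[R]_n) : continuous (dither omega r a).
Proof.
move=> t; apply: cvg_rV => i; rewrite mxE.
under eq_fun do rewrite mxE.
by apply: cvgMl_tmp; exact: continuous_sinM.
Qed.

Lemma average_gradient_estimate_error (R : realType) (n : nat)
    (J : 'rV[R]_n -> R) (omega : R) (r : 'I_n -> int) (a theta : 'rV[R]_n)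
    (i : 'I_n) (e : R) :
  continuous J -> 0 < omega -> r i != 0 ->
  (forall j, i != j -> `|r i| != `|r j|) -> a 0 i != 0 ->
  (forall h : 'rV[R]_n, `|h| <= `|a| ->
    `|J (theta + h) - (J theta + \sum_j h 0 j * gradient J theta 0 j)|
      <= e) ->
  `|average_gradient_estimate J omega r a theta 0 i - gradient J theta 0 i|
    <= 2 / `|a 0 i| * e.
Proof.
move=> cJ w0 ri0 rinj ai0 He; have T0 := period_gt0 w0.
rewrite mxE.
rewrite -[X in _ - X](average_demodulation_affine (gradient J theta) (J theta)
  w0 ri0 rinj ai0).
set m := demodulation _ _ _ _; set s := dither _ _ _.
have cm : continuous m by exact: continuous_demodulation.
have cs : continuous s by exact: continuous_dither.
have cJs : continuous (fun t => J (theta + s t)).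
  move=> t; apply: (@continuous_comp _ _ _ (fun t => theta + s t) J);
    last exact: cJ.
  by apply: cvgD; [exact: cvg_cst|exact: cs].
have cL : continuous (fun t => J theta + \sum_j s t 0 j * gradient J theta 0 j).
  move=> t; apply: cvgD; first exact: cvg_cst.
  apply: continuous_sumr => j {}t; apply: cvgMr_tmp.
  by apply: (@continuous_comp _ _ _ s (fun M : 'rV_n => M 0 j));
    [exact: cs|exact: coord_continuous].
have cmJ : continuous (fun t => m t * J (theta + s t)).
  by move=> t; apply: cvgM; [exact: cm|exact: cJs].
have cmL : continuous (fun t => m t *
    (J theta + \sum_j s t 0 j * gradient J theta 0 j)).
  by move=> t; apply: cvgM; [exact: cm|exact: cL].
rewrite -mulrBr -RintegralB //; try exact: continuous_integrable_itv.
rewrite normrM gtr0_norm ?invr_gt0 // mulrC ler_pdivrMr //.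
have cd : continuous (fun t => m t * J (theta + s t) - m t *
    (J theta + \sum_j s t 0 j * gradient J theta 0 j)).
  by move=> t; apply: cvgB; [exact: cmJ|exact: cmL].
apply: le_trans (le_normr_Rintegral _ _) _ => //.
  exact: continuous_integrable_itv.
rewrite -(Rintegral_cst_itv _ (ltW T0)); apply: le_Rintegral => //.
- by apply: continuous_integrable_itv => t; apply: cvg_norm; exact: cd.
- by apply: continuous_integrable_itv => t; exact: cvg_cst.
move=> t _; rewrite -mulrBr normrM ler_pM //; last exact/He/norm_dither.
by rewrite normrM normf_div (ger0_norm (ler0n _ 2)) ler_piMr ?sin_max.
Qed.

Theorem lemma2 (R : realType) (n : nat) (J : 'rV[R]_n -> R) (omega : R)
    (r : 'I_n -> int) (rho : 'rV[R]_n)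
    (J_C1 : continuously_differentiable J)
    (omega_gt0 : 0 < omega)
    (r_neq0 : forall i, r i != 0)
    (r_inj : forall i j, i != j -> `|r i| != `|r j|)
    (rho_neq0 : forall i, rho 0 i != 0)
    (rho_size : dither_size rho = 1)
    (theta : 'rV[R]_n) :
  average_gradient_estimate J omega r (a0 *: rho) theta @[a0 --> 0^'+]
    --> gradient J theta.
Proof.
have dJ := J_C1.1.
have cJ : continuous J by move=> x; exact/differentiable_continuous/dJ.
apply: cvg_rV => i; apply/cvgrPdist_le => e e_gt0.
have rhoi_gt0 : 0 < `|rho 0 i| by rewrite normr_gt0.
have rho_gt0 : 0 < `|rho| := lt_le_trans rhoi_gt0 (le_mx_norm rho 0 i).
pose eta := e * `|rho 0 i| / (2 * `|rho|).
have eta_gt0 : 0 < eta by rewrite divr_gt0 ?mulr_gt0.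
have /nbhs_ballP[d /= d_gt0 Hd] := gradient_remainder (dJ theta) eta_gt0.
near=> a0.
have a0_gt0 : 0 < a0 by near: a0; exact: nbhs_right_gt.
have a0_lt : a0 * `|rho| < d.
  rewrite -ltr_pdivlMr //; near: a0; apply: nbhs_right_lt.
  by rewrite divr_gt0.
have -> : e = 2 / `|(a0 *: rho) 0 i| * (eta * (a0 * `|rho|)).
  rewrite mxE normrM (gtr0_norm a0_gt0) /eta; field.
  by rewrite !lt0r_neq0.
rewrite distrC; apply: average_gradient_estimate_error => //.
- exact: r_inj.
- by rewrite mxE mulf_neq0 // lt0r_neq0.
move=> h; rewrite normrZ (gtr0_norm a0_gt0) => h_le.
apply: le_trans (Hd h _) _.
  by rewrite -ball_normE /= sub0r normrN (le_lt_trans h_le).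
by rewrite ler_pM2l.
Unshelve. all: by end_near. Qed.
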